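(* Let $\preceq$ be an admissible order on $L_n([0,1])$, let $\omega=(w_1,\ldots,w_m)$ be a weighting vector, and let $\mathcal{L}'_n([0,1])=\langle L_n([0,1]),+,\star,\preceq\rangle$ be an ordered semi-vector space over $U$ (with vector addition $+$ and scalar multiplication $\star$). Then the function $OWA_\omega^{\mathcal{L}'_n([0,1])}:L_n([0,1])^m\to L_n([0,1])$ defined by $$OWA_\omega^{\mathcal{L}'_n([0,1])}(\mathbf{x}_1,\ldots,\mathbf{x}_m)=\sum_{j=1}^m w_j\star\mathbf{x}_{(j)},$$ where the sum is with respect to $+$, $\mathbf{x}_{(j+1)}\preceq\mathbf{x}_{(j)}$ for each $j\in\{1,\ldots,m-1\}$ and $\{(1),\ldots,(m)\}=\{1,\ldots,m\}$, is an idempotent $m$-ary $n$-dimensional aggregation function with respect to $\preceq$.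
   Context: $L_n([0,1])=\{(x_1,\ldots,x_n)\in[0,1]^n : x_1\leq\cdots\leq x_n\}$. The product order on $L_n([0,1])$ is: $\mathbf{x}\leq_n^p\mathbf{y}$ iff $x_i\leq y_i$ for all $i$. A total order $\preceq$ on $L_n([0,1])$ is admissible if $\mathbf{x}\leq_n^p\mathbf{y}$ implies $\mathbf{x}\preceq\mathbf{y}$. For $x\in[0,1]$, $/x/=(x,\ldots,x)\in L_n([0,1])$. A weighting vector is $\omega=(w_1,\ldots,w_m)\in[0,1]^m$ with $\sum_{i=1}^m w_i=1$. $U=\langle[0,1],\dotplus,\cdot\rangle$, where $\cdot$ is the usual multiplication and $r\dotplus s=\min(1,r+s)$; the paper treats $U$ as a weak semifield (an algebra with associative commutative operations $\boxplus,\cdot$, with $\cdot$ distributive over $\boxplus$, an additive identity $0$ and a multiplicative identity $1$). An ordered semi-vector space over $U$ with underlying set $V$, operations $+:V\times V\to V$, $\star:[0,1]\times V\to V$, and partial order $\leq$ on $V$ is one satisfying, for all $x,y,z\in V$, $r,s\in[0,1]$: (SV1) $x+(y+z)=(x+y)+z$; (SV2) $x+y=y+x$; (SV3) $r\star(s\star x)=(r\cdot s)\star x$; (SV4) $1\star x=x$; (SV5) $r\star(x+y)=(r\star x)+(r\star y)$; (SV6) $(r\dotplus s)\star x=(r\star x)+(s\star x)$; (SV7) there is $\mathbf{0}\in V$ with $\mathbf{0}+x=x$ for all $x\in V$; (SV8) $x\leq y$ implies $r\star x\leq r\star y$; (SV9) $x\leq y$ implies $x+z\leq y+z$. A function $\mathcal{A}:L_n([0,1])^m\to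 L_n([0,1])$ is an $m$-ary $n$-dimensional aggregation function with respect to $\preceq$ if $\mathcal{A}(/0/,\ldots,/0/)=/0/$, $\mathcal{A}(/1/,\ldots,/1/)=/1/$, and $\mathcal{A}(\mathbf{x}_1,\ldots,\mathbf{x}_m)\preceq\mathcal{A}(\mathbf{y}_1,\ldots,\mathbf{y}_m)$ whenever $\mathbf{x}_j\preceq\mathbf{y}_j$ for each $j\in\{1,\ldots,m\}$. It is idempotent if $\mathcal{A}(\mathbf{x},\ldots,\mathbf{x})=\mathbf{x}$ for each $\mathbf{x}\in L_n([0,1])$. *)

(* Defs.v *)
From HB Require Import structures.
From mathcomp Require Import all_boot all_order all_algebra all_fingroup.
From mathcomp Require Import interval_inference reals.

Set Implicit Arguments.
Unset Strict Implicit.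
Unset Printing Implicit Defensive.
Import Order.TTheory GRing.Theory Num.Theory.
Local Open Scope ring_scope.

Record Ln (R : realType) (n : nat) := MkLn {
  Ln_val :> n.-tuple {i01 R};
  Ln_sorted : sorted <=%R Ln_val }.

HB.instance Definition _ R n := [isSub for @Ln_val R n].
HB.instance Definition _ R n := [Choice of Ln R n by <:].

Definition prod_le (R : realType) (n : nat) (x y : Ln R n) : Prop :=
  forall i : 'I_n, tnth x i <= tnth y i.

Fact sorted_nseq (R : realType) (n : nat) (r : {i01 R}) :
  sorted <=%R (nseq_tuple n r).
Proof. by case: n => //= n; elim: n => //= n ->; rewrite lexx. Qed.

(* The degenerate element $/r/ = (r, ..., r)$. *)
Definition degen (R : realType) (n : nat) (r : {i01 R}) : Ln R n :=
  MkLn (sorted_nseq n r).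

Record partial_order (V : Type) (le : rel V) : Prop := PartialOrder {
  po_refl : reflexive le;
  po_anti : antisymmetric le;
  po_trans : transitive le }.

Record admissible_order (R : realType) (n : nat) (le : rel (Ln R n)) : Prop :=
  AdmissibleOrder {
  adm_po : partial_order le;
  adm_total : total le;
  adm_refine : forall x y, prod_le x y -> le x y }.

Definition tadd (R : realType) (r s : {i01 R}) : {i01 R} :=
  (Num.min 1 (r%:num + s%:num))%:i01.

Definition umul (R : realType) (r s : {i01 R}) : {i01 R} :=
  (r%:num * s%:num)%:i01.

(* Ordered semi-vector spaces over $U = \langle [0,1], \dotplus, \cdot\rangle$.
   The zero vector, whose existence is an axiom, is recorded as a field: it is
   unique, and it serves as the empty sum. *)
Record ordered_semivector_space (R : realType) (V : Type) (le : rel V) :=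
  OrderedSemivectorSpace {
  sv_add : V -> V -> V;
  sv_scale : {i01 R} -> V -> V;
  sv_zero : V;
  sv_po : partial_order le;
  sv_addA : forall x y z, sv_add x (sv_add y z) = sv_add (sv_add x y) z;
  sv_addC : forall x y, sv_add x y = sv_add y x;
  sv_scaleA : forall r s x,
    sv_scale r (sv_scale s x) = sv_scale (umul r s) x;
  sv_scale1 : forall x, sv_scale 1%:i01 x = x;
  sv_scaleDr : forall r x y,
    sv_scale r (sv_add x y) = sv_add (sv_scale r x) (sv_scale r y);
  sv_scaleDl : forall r s x,
    sv_scale (tadd r s) x = sv_add (sv_scale r x) (sv_scale s x);
  sv_add0 : forall x, sv_add sv_zero x = x;
  sv_le_scale : forall r x y, le x y -> le (sv_scale r x) (sv_scale r y);
  sv_le_add : forall x y z, le x y -> le (sv_add x z) (sv_add y z) }.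

Definition weighting_vector (R : realType) (m : nat)
    (w : m.-tuple {i01 R}) : Prop :=
  \sum_(j < m) (tnth w j)%:num = 1.

(* $(\mathbf{x}_{(1)}, ..., \mathbf{x}_{(m)})$, in decreasing order. *)
Definition rearrange (V : Type) (le : rel V) (m : nat) (x : m.-tuple V) :
    m.-tuple V :=
  [tuple of sort (fun a b => le b a) x].

Definition OWA (R : realType) (n m : nat) (le : rel (Ln R n))
    (S : ordered_semivector_space R le) (w : m.-tuple {i01 R})
    (x : m.-tuple (Ln R n)) : Ln R n :=
  \big[sv_add S/sv_zero S]_(j < m)
    sv_scale S (tnth w j) (tnth (rearrange le x) j).

Record aggregation_function (R : realType) (n m : nat) (le : rel (Ln R n))
    (A : m.-tuple (Ln R n) -> Ln R n) : Prop := AggregationFunction {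
  agg0 : A (nseq_tuple m (degen n 0%:i01)) = degen n 0%:i01;
  agg1 : A (nseq_tuple m (degen n 1%:i01)) = degen n 1%:i01;
  agg_mono : forall x y : m.-tuple (Ln R n),
    (forall j : 'I_m, le (tnth x j) (tnth y j)) -> le (A x) (A y) }.

Definition idempotent_agg (R : realType) (n m : nat)
    (A : m.-tuple (Ln R n) -> Ln R n) : Prop :=
  forall x : Ln R n, A (nseq_tuple m x) = x.

(* Any permutation that arranges the arguments decreasingly may be used to
   compute [OWA], and there is always one. *)
Definition arranges (V : Type) (le : rel V) (m : nat) (x : m.-tuple V)
    (s : 'S_m) : Prop :=
  forall i j : 'I_m, j = i.+1 :> nat -> le (tnth x (s j)) (tnth x (s i)).

Lemma rearrange_perm (V : eqType) (le : rel V) (m : nat) (x : m.-tuple V)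
    (s : 'S_m) : partial_order le -> total le -> arranges le x s ->
  rearrange le x = [tuple tnth x (s j) | j < m].
Proof.
move=> [_ anti trans] tot dec; apply/val_inj => /=.
set ge := fun a b => le b a.
have getr : transitive ge by move=> b a c /= ab bc; apply: trans bc ab.
have gean : antisymmetric ge by move=> a b; rewrite /ge andbC; apply: anti.
have gett : total ge by move=> a b; apply: tot.
apply: (sorted_eq getr gean (sort_sorted gett _)).
  case: m x s dec => [|m] x s dec.
    by rewrite (size0nil (s := [seq _ | _ <- _])) // size_map size_enum_ord.
  apply/(sortedP (tnth x ord0)) => i; rewrite size_map size_enum_ord => im.
  have im' : (i < m.+1)%N by apply: ltnW.
  rewrite /= !(nth_map ord0) -?enumT ?size_enum_ord// /ge; apply: dec.
  by rewrite !nth_enum_ord.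
by rewrite perm_sort perm_sym; apply/tuple_permP; exists s.
Qed.

Lemma arranges_exists (V : eqType) (le : rel V) (m : nat) (x : m.-tuple V) :
  total le -> exists s : 'S_m, arranges le x s.
Proof.
move=> tot; set ge := fun a b => le b a.
have gett : total ge by move=> a b; apply: tot.
have /tuple_permP[s es] : perm_eq (sort ge x) x by rewrite perm_sort.
exists s => i j ji; have := sort_sorted gett x; rewrite es.
move=> /(sortedP (tnth x i)) /(_ i); rewrite size_map size_enum_ord -ji => H.
have := H (ltn_ord j).
by rewrite /= !(nth_map i) -?enumT ?size_enum_ord// -?ji !nth_ord_enum.
Qed.

Lemma OWA_perm (R : realType) (n m : nat) (le : rel (Ln R n))
    (S : ordered_semivector_space R le) (w : m.-tuple {i01 R})
    (x : m.-tuple (Ln R n)) (s : 'S_m) : total le -> arranges le x s ->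
  OWA S w x =
    \big[sv_add S/sv_zero S]_(j < m) sv_scale S (tnth w j) (tnth x (s j)).
Proof.
move=> tot dec; rewrite /OWA (rearrange_perm (sv_po S) tot dec).
by apply: eq_bigr => j _; rewrite tnth_mktuple.
Qed.

(* Main.v *)
Require Import Defs.
From mathcomp Require Import all_boot all_order all_algebra.
From mathcomp Require Import interval_inference reals.

(** Both axioms of an ordered semi-vector space that involve the order say that
    a weighted sum is monotone in each of its vectors, so [OWA] is monotone as
    soon as arranging two families decreasingly preserves their entrywise
    comparison.  It does, because the entry of rank [j] of a decreasing
    arrangement lies above a threshold [t] exactly when more than [j] entries
    of the family do ([le_nth_decreasing]), and raising the entries can only
    raise such a count ([le_rearrange]).

    Every arrangement of a constant family is constant, so idempotence amounts to
    collecting scalars: [\sum_j w_j * x = (\sum_j w_j) * x], where the scalar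
    sum is the truncated one.  Truncating at every step is the same as
    truncating the real sum once ([num_big_tadd]), and the weights add up
    to [1].  Collecting scalars fails for the empty family, since the axioms
    do not force the scalar [0] to send [x] to the zero vector; but a weighting
    vector is never empty.  The two boundary conditions are instances of
    idempotence. *)

Set Implicit Arguments.
Unset Strict Implicit.
Unset Printing Implicit Defensive.
Import Order.TTheory GRing.Theory Num.Theory.
Local Open Scope ring_scope.

(** Thresholds characterize the entries of a decreasing sequence by counts,
    which do not depend on the order of the entries. *)
Lemma le_nth_decreasing (V : Type) (le : rel V) (t x0 : V) (s : seq V)
    (j : nat) : transitive le -> sorted (fun a b => le b a) s ->
  (j < size s)%N -> le t (nth x0 s j) = (j < count (le t) s)%N.
Proof.
move=> tr; elim: s j => // a s IHs j /= pas.
have getr : transitive (fun a b => le b a) by move=> b c d /= bc /tr; apply.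
case: (boolP (le t a)) => [ta | nta].
  by case: j => [|j] //= js; rewrite IHs // (path_sorted pas).
(* All later entries are below [a], hence fail to be above [t] as well. *)
have nts : ~~ has (le t) s.
  rewrite -all_predC; apply: sub_all (order_path_min getr pas) => b /= ba.
  by apply: contra nta => tb; apply: tr tb ba.
have c0 : count (le t) s = 0%N by apply/eqP; rewrite -leqn0 leqNgt -has_count.
case: j => [|j] /= js; rewrite c0 ?(negbTE nta) //.
by rewrite IHs ?c0 ?(path_sorted pas).
Qed.

Lemma leq_count_tuple (V : Type) (m : nat) (p : pred V) (x y : m.-tuple V) :
  (forall i, p (tnth x i) -> p (tnth y i)) -> (count p x <= count p y)%N.
Proof.
move=> pxy; rewrite -!sum1_count !big_tuple !(big_mkcond (fun i => p _)).
by apply: leq_sum => i _; have := pxy i; case: (p (tnth x i)) => // ->.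
Qed.

Lemma le_rearrange (V : Type) (le : rel V) (m : nat) (x y : m.-tuple V) :
  total le -> transitive le -> (forall i, le (tnth x i) (tnth y i)) ->
  forall j, le (tnth (rearrange le x) j) (tnth (rearrange le y) j).
Proof.
move=> tot tr lexy j; set t := tnth (rearrange le x) j.
have gett : total (fun a b => le b a) by move=> a b; apply: tot.
have above z : le t (tnth (rearrange le z) j) = (j < count (le t) z)%N.
  rewrite (tnth_nth t) /= le_nth_decreasing ?sort_sorted ?count_sort //.
  by rewrite size_sort size_tuple.
have : le t t by have := tot t t; rewrite orbb.
(* Reflexivity at [t], an entry of the first arrangement, read as a count. *)
rewrite {2}/t !above => /leq_trans; apply.
by apply: leq_count_tuple => i ti; apply: tr ti (lexy i).
Qed.

Lemma num_big_tadd (R : realType) (s : seq {i01 R}) :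
  (\big[@tadd R/0%:i01]_(r <- s) r)%:num = Num.min 1 (\sum_(r <- s) r%:num).
Proof.
elim: s => [|r s IHs]; first by rewrite !big_nil /= min_r.
(* The inner truncation yields the bound [r + 1], weaker than the outer [1]. *)
rewrite !big_cons /= IHs addr_minr minA; congr Num.min.
by rewrite min_l // lerDr.
Qed.

Lemma sv_add_mono (R : realType) (V : Type) (le : rel V)
    (S : ordered_semivector_space R le) (x y z t : V) :
  le x y -> le z t -> le (sv_add S x z) (sv_add S y t).
Proof.
move=> lexy lezt; apply: (po_trans (sv_po S)) (sv_le_add S z lexy) _.
by rewrite ![sv_add S y _]sv_addC; apply: sv_le_add.
Qed.

(** The family is written [r :: s] because the empty sum is the zero vector,
    which [0 * x] may differ from: with [x + y] a join and [r * x = x], scalars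
    act trivially.  Induction therefore starts at a single scalar. *)
Lemma sv_scale_big (R : realType) (V : Type) (le : rel V)
    (S : ordered_semivector_space R le) (x : V) (r : {i01 R})
    (s : seq {i01 R}) :
  \big[sv_add S/sv_zero S]_(q <- r :: s) sv_scale S q x =
  sv_scale S (\big[@tadd R/0%:i01]_(q <- r :: s) q) x.
Proof.
elim: s r => [|q s IHs] r; last first.
  by rewrite big_cons IHs [in RHS]big_cons sv_scaleDl.
rewrite big_cons big_nil sv_addC sv_add0; congr (sv_scale S _ x).
by apply/val_inj; rewrite /= num_big_tadd big_seq1 min_r.
Qed.

Lemma sv_scale_weights (R : realType) (V : Type) (le : rel V)
    (S : ordered_semivector_space R le)
    (m : nat) (w : m.-tuple {i01 R}) (x : V) :
  weighting_vector w ->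
  \big[sv_add S/sv_zero S]_(j < m) sv_scale S (tnth w j) x = x.
Proof.
rewrite /weighting_vector -(big_tuple _ _ w xpredT (fun r => r%:num)).
rewrite -(big_tuple _ _ w xpredT (fun r => sv_scale S r x)).
case: {w}(tval w) => [|r s] sum1.
  by have /eqP := sum1; rewrite big_nil eq_sym oner_eq0.
rewrite sv_scale_big -[RHS](sv_scale1 S); congr (sv_scale S _ x).
by apply/val_inj; rewrite /= num_big_tadd sum1 minxx.
Qed.

Theorem theorem2 (R : realType) (n m : nat) (le : rel (Ln R n))
    (w : m.-tuple {i01 R}) (S : ordered_semivector_space R le) :
  admissible_order le -> weighting_vector w ->
  aggregation_function le (OWA S w) /\ idempotent_agg (OWA S w).
Proof.
move=> [[refl _ tr] tot _] sum1.
have idem : idempotent_agg (OWA S w).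
  move=> x; have nseqE j : tnth (nseq_tuple m x) j = x.
    by rewrite (tnth_nth x) nth_nseq ltn_ord.
  have [s arr] := arranges_exists (nseq_tuple m x) tot.
  rewrite (OWA_perm S w tot arr).
  rewrite -[RHS](sv_scale_weights S x sum1).
  by apply: eq_bigr => j _; rewrite nseqE.
split=> //; split=> // x y lexy.
apply: (big_rec2 (fun a b => le a b)) => // j a b _ leab.
by apply: sv_add_mono leab; apply: sv_le_scale; apply: le_rearrange.
Qed.
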